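(* Let $\Phi_\Theta$ be a modified U-net of depth $L$ as described in the context, in the inference process after training (so that the batch-normalization statistics are fixed constants). Suppose that all the entries of the convolution matrices $K^k$ with $k\ge2$ (that is, of every convolution except the first one, $K^1$), all the entries of all the batch-normalization scale vectors $\boldsymbol{\gamma}^k$, $k\ge1$, and all the entries of the last bias term $\boldsymbol{b}^L$ are nonnegative. Then $\Phi_\Theta$ is component-wise convex (each component of $\Phi_\Theta(\boldsymbol{x})$ is a convex function of the input $\boldsymbol{x}$) and has nonnegative output, i.e. all the components of $\boldsymbol{z}^{L+1}=\Phi_\Theta(\boldsymbol{x})$ are nonnegative for every input $\boldsymbol{x}$.
   Context: Images (with several channels) are identified with column vectors by reshaping. The concatenation of two vectors is $C(\boldsymbol{u},\boldsymbol{v})=(u_1,\dots,u_m,v_1,\dots,v_n)^T$. $\operatorname{ReLU}(\boldsymbol{u})=\max\{0,\boldsymbol{u}\}$ component-wise. $\operatorname{max-pool}_{2\times2}$ partitions each channel of an image into $2\times2$ sub-matrices and returns the matrix of the maxima of the sub-matrices. A convolution is a linear operator, represented by a tensor of dimension $f_1\times f_2\times c_1\times c_2$ ($f_1\times f_2$ filter size, $c_1,c_2$ numbers of input and output channels) and written as a matrix $K^k$ acting on vectorized images. Zero padding is the embedding of an image into a larger zero image and is written as a matrix $P_0$ with entries in $\{0,1\}$. A modified U-net $\Phi_\Theta$ of depth $L$ maps an input image $\boldsymbol{x}$ to an output image as follows. Put $\boldsymbol{z}^1=\boldsymbol{x}$ and $\boldsymbol{z}^{k+1}=\sigma^k(\hat{\boldsymbol{b}}^k+W^k\hat{\boldsymbol{z}}^k)$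 for $k=1,\dots,L$, where either $\hat{\boldsymbol{z}}^k=\boldsymbol{z}^k$ or (concatenation) $\hat{\boldsymbol{z}}^k=C(\boldsymbol{z}^{i_k},\boldsymbol{z}^k)$ with $i_k\in\{1,\dots,k\}$, and $\Phi_\Theta(\boldsymbol{x})=\boldsymbol{z}^{L+1}$. The layers $1,\dots,L$ are grouped into consecutive blocks, the first of which is a right arrow, of the following types, arranged in a contracting path (right and down arrows) followed by a symmetric expanding path (up and right arrows), and ending with the last right arrow: - Right arrow (two consecutive layers $k,k+1$), realizing $\operatorname{ReLU}(\operatorname{BN}(\boldsymbol{b}^k+K^kP_0\hat{\boldsymbol{z}}^k))$: layer $k$ has $W^k=K^kP_0$, $\hat{\boldsymbol{b}}^k=\boldsymbol{b}^k$, $\sigma^k(\boldsymbol{u})=\dfrac{\boldsymbol{u}-\mathbb{E}(\mathcal{B}^k)}{\sqrt{\operatorname{Var}(\mathcal{B}^k)+\epsilon}}$ (component-wise), and layer $k+1$ has $\hat{\boldsymbol{z}}^{k+1}=\boldsymbol{z}^{k+1}$, $W^{k+1}=\operatorname{diag}(\boldsymbol{\gamma}^k)$, $\hat{\boldsymbol{b}}^{k+1}=\boldsymbol{\beta}^k$, $\sigma^{k+1}=\operatorname{ReLU}$. Here $K^k$ is a convolution with filter size $3\times3$ and stride $1$. In the expanding path, concatenation $\hat{\boldsymbol{z}}^k=C(\boldsymbol{z}^{i_k},\boldsymbol{z}^k)$ is applied before the first convolution of each level. - Down arrow (one layer $i$): $\hat{\boldsymbol{b}}^i=\boldsymbol{0}$,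 $W^i=I$, $\sigma^i=\operatorname{max-pool}_{2\times2}$. - Up arrow (two layers): the same form as a right arrow, with filter size $2\times2$ and a different zero padding, whose matrix $P_0$ still has entries in $\{0,1\}$. - Last right arrow (layer $L$): $W^L=K^LP_0$, $\hat{\boldsymbol{b}}^L=\boldsymbol{b}^L$, $\sigma^L(\boldsymbol{u})=\boldsymbol{u}$, where $K^L$ is a convolution with filter size $1\times1$ and one output channel, and all components of $\boldsymbol{b}^L$ are equal to one scalar $b_0^L\in\mathbb{R}$. The layer immediately preceding layer $L$ is a ReLU layer. The parameters $K^k,\boldsymbol{b}^k,\boldsymbol{\gamma}^k,\boldsymbol{\beta}^k$ are indexed by the layer $k$ at which the corresponding convolution occurs, so $K^1$ is the first convolution. In the inference process after training, the batch-normalization statistics $\mathbb{E}(\mathcal{B}^k)$ (mean) and $\operatorname{Var}(\mathcal{B}^k)\ge0$ (variance) are fixed constants, independent of the input, and $\epsilon>0$ is a fixed constant. *)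

(* Defs.v *)
From HB Require Import structures.
From mathcomp Require Import all_boot all_order all_algebra.
From mathcomp Require Import all_classical all_reals.
From mathcomp Require Import convex.

Set Implicit Arguments.
Unset Strict Implicit.
Unset Printing Implicit Defensive.

Import Order.TTheory GRing.Theory Num.Theory.

Local Open Scope ring_scope.

Record img_shape := Shape { channels : nat; height : nat; width : nat }.

Definition sdim (s : img_shape) : nat := (channels s * (height s * width s))%N.

(* An image is a column vector, ordered by channel, then row, then column. *)
Definition img (R : realType) (s : img_shape) : Type := 'cV[R]_(sdim s).

Definition pixel (s : img_shape) (c : 'I_(channels s)) (i : 'I_(height s))
    (j : 'I_(width s)) : 'I_(sdim s) :=
  mxvec_index c (mxvec_index i j).

Definition mxvec_unindex (m n : nat) (k : 'I_(m * n)) : 'I_m * 'I_n :=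
  enum_val (cast_ord (esym (mxvec_cast m n)) k).

Lemma mxvec_indexK (m n : nat) (i : 'I_m) (j : 'I_n) :
  mxvec_unindex (mxvec_index i j) = (i, j).
Proof. by rewrite /mxvec_unindex /mxvec_index cast_ordK enum_rankK. Qed.

Definition chan_of (s : img_shape) (k : 'I_(sdim s)) : 'I_(channels s) :=
  (mxvec_unindex k).1.
Definition row_of (s : img_shape) (k : 'I_(sdim s)) : 'I_(height s) :=
  (mxvec_unindex (mxvec_unindex k).2).1.
Definition col_of (s : img_shape) (k : 'I_(sdim s)) : 'I_(width s) :=
  (mxvec_unindex (mxvec_unindex k).2).2.

Arguments chan_of : clear implicits.
Arguments row_of : clear implicits.
Arguments col_of : clear implicits.

Lemma pixelK (s : img_shape) (c : 'I_(channels s)) (i : 'I_(height s))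
    (j : 'I_(width s)) :
  [/\ chan_of s (pixel c i j) = c, row_of s (pixel c i j) = i
    & col_of s (pixel c i j) = j].
Proof.
by split; rewrite /chan_of /row_of /col_of /pixel !mxvec_indexK /= ?mxvec_indexK.
Qed.

(* Since images are stored channel by channel, stacking the two column vectors
   is concatenation along the channels; [castmx] only rewrites the dimension. *)
Definition concat_shape (s t : img_shape) : img_shape :=
  Shape (channels s + channels t) (height t) (width t).

Lemma concat_sdim (s t : img_shape) :
  height s = height t -> width s = width t ->
  (sdim s + sdim t)%N = sdim (concat_shape s t).
Proof. by move=> eh ew; rewrite /sdim /= mulnDl eh ew. Qed.

Definition concat (R : realType) (s t : img_shape) (eh : height s = height t)
    (ew : width s = width t) (u : img R s) (v : img R t) :
    img R (concat_shape s t) :=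
  castmx (concat_sdim eh ew, erefl 1%N) (col_mx u v).

Record padding :=
  Padding { ptop : nat; pbottom : nat; pleft : nat; pright : nat }.

Definition pad_shape (q : padding) (s : img_shape) : img_shape :=
  Shape (channels s) (ptop q + height s + pbottom q)
    (pleft q + width s + pright q).

Definition pad_mx (R : realType) (q : padding) (s : img_shape) :
    'M[R]_(sdim (pad_shape q s), sdim s) :=
  \matrix_(k < sdim (pad_shape q s), l < sdim s)
    [&& chan_of (pad_shape q s) k == chan_of s l,
        row_of (pad_shape q s) k == (ptop q + row_of s l)%N :> nat
      & col_of (pad_shape q s) k == (pleft q + col_of s l)%N :> nat]%:R.

Definition tensor (R : realType) (f1 f2 c1 c2 : nat) : Type :=
  'I_f1 -> 'I_f2 -> 'I_c1 -> 'I_c2 -> R.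

Definition conv_shape (f1 f2 c2 : nat) (s : img_shape) : img_shape :=
  Shape c2 ((height s).+1 - f1) ((width s).+1 - f2).

(* Stride 1, no implicit padding:
   y(o, i, j) = \sum_(a, b, c) T(a, b, c, o) * x(c, i + a, j + b). *)
Definition conv_mx (R : realType) (f1 f2 c2 : nat) (s : img_shape)
    (T : tensor R f1 f2 (channels s) c2) :
    'M[R]_(sdim (conv_shape f1 f2 c2 s), sdim s) :=
  let t := conv_shape f1 f2 c2 s in
  \matrix_(k < sdim t, l < sdim s) \sum_(a < f1) \sum_(b < f2)
    T a b (chan_of s l) (chan_of t k)
      *+ ((row_of s l == (row_of t k + a)%N :> nat)
          && (col_of s l == (col_of t k + b)%N :> nat)).

Definition relu (R : realType) (n : nat) (u : 'cV[R]_n) : 'cV[R]_n :=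
  \col_i Num.max 0 (u i 0).

Definition normalize (R : realType) (n : nat) (eps : R) (mean var u : 'cV[R]_n) :
    'cV[R]_n :=
  \col_i ((u i 0 - mean i 0) / Num.sqrt (var i 0 + eps)).

Lemma double_half_lt (n : nat) (b : bool) (i : 'I_n./2) : (i.*2 + b < n)%N.
Proof.
have hi : (i.+1.*2 <= n)%N.
  rewrite (leq_trans _ (leq_subr (odd n) n)) //.
  by rewrite -[n in (n - _)%N]odd_double_half addKn leq_double.
by apply: leq_trans hi; rewrite doubleS; case: b; rewrite ?addn1 ?addn0.
Qed.

Definition dbl (n : nat) (i : 'I_n./2) (b : bool) : 'I_n :=
  Ordinal (double_half_lt b i).

Definition pool_shape (s : img_shape) : img_shape :=
  Shape (channels s) (height s)./2 (width s)./2.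

Definition maxpool (R : realType) (s : img_shape) (z : img R s) :
    img R (pool_shape s) :=
  let t := pool_shape s in
  \col_(k < sdim t)
    let x a b :=
      z (@pixel s (chan_of t k) (dbl (row_of t k) a) (dbl (col_of t k) b)) 0 in
    Num.max (Num.max (x false false) (x false true))
            (Num.max (x true false) (x true true)).

Definition layer (R : realType) (m n p : nat) (sigma : 'cV[R]_n -> 'cV[R]_p)
    (b : 'cV[R]_n) (W : 'M[R]_(n, m)) (z : 'cV[R]_m) : 'cV[R]_p :=
  sigma (b + W *m z).

(* Parameters of a convolution with batch normalization and ReLU, acting on
   images that have the shape [s] after padding. *)
Record conv_bn (R : realType) (f1 f2 : nat) (s : img_shape) := ConvBN {
  out_channels : nat;
  kernel : tensor R f1 f2 (channels s) out_channels;
  bias : img R (conv_shape f1 f2 out_channels s);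
  bn_mean : img R (conv_shape f1 f2 out_channels s);
  bn_var : img R (conv_shape f1 f2 out_channels s);
  bn_var_ge0 : forall i, 0 <= bn_var i 0;
  bn_scale : img R (conv_shape f1 f2 out_channels s);
  bn_shift : img R (conv_shape f1 f2 out_channels s) }.

Arguments kernel {R f1 f2 s}.

Definition out_shape (R : realType) (f1 f2 : nat) (s : img_shape)
    (a : conv_bn R f1 f2 s) : img_shape :=
  conv_shape f1 f2 (out_channels a) s.

Definition conv_layer (R : realType) (eps : R) (f1 f2 : nat) (s : img_shape)
    (n : nat) (a : conv_bn R f1 f2 s) (P0 : 'M[R]_(sdim s, n)) (z : 'cV[R]_n) :
    img R (out_shape a) :=
  layer (normalize eps (bn_mean a) (bn_var a)) (bias a) (conv_mx (kernel a) *m P0) z.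

Definition scale_layer (R : realType) (f1 f2 : nat) (s : img_shape)
    (a : conv_bn R f1 f2 s) (z : img R (out_shape a)) : img R (out_shape a) :=
  layer (@relu R _) (bn_shift a) (diag_mx (bn_scale a)^T) z.

(* The tuple (z^k, ..., z^1) of the layer values so far, latest first. *)
Fixpoint history (R : realType) (ss : seq img_shape) : Type :=
  if ss is s :: ss' then (img R s * history R ss')%type else unit.

Definition shape0 : img_shape := Shape 0 0 0.

Fixpoint recall (R : realType) (ss : seq img_shape) :
    history R ss -> forall j : nat, img R (nth shape0 ss j) :=
  match ss return history R ss -> forall j, img R (nth shape0 ss j) with
  | [::] => fun _ j => 0
  | s :: ss' => fun h j =>
      match j return img R (nth shape0 (s :: ss') j) with
      | 0%N => h.1
      | j'.+1 => recall h.2 j'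
      end
  end.

(* [unet_path R s0 ss]: the arrows up to some layer k - 1, for input images of
   shape [s0]; [ss] lists the shapes of z^k, ..., z^1.  In [ConcatRight p j ...]
   the image concatenated with z^k is z^(k - j), so that i_k = k - j ranges over
   1, ..., k.  The only property of the zero padding [P0] of an up arrow that is
   required is that its entries are 0 or 1. *)
Inductive unet_path (R : realType) (s0 : img_shape) : seq img_shape -> Type :=
| Input : unet_path R s0 [:: s0]
| Right s ss (p : unet_path R s0 (s :: ss)) (q : padding)
    (a : conv_bn R 3 3 (pad_shape q s)) :
    unet_path R s0 [:: out_shape a, out_shape a, s & ss]
| ConcatRight s ss (p : unet_path R s0 (s :: ss)) (j : 'I_(size (s :: ss)))
    (eh : height (nth shape0 (s :: ss) j) = height s)
    (ew : width (nth shape0 (s :: ss) j) = width s)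
    (q : padding)
    (a : conv_bn R 3 3 (pad_shape q (concat_shape (nth shape0 (s :: ss) j) s))) :
    unet_path R s0 [:: out_shape a, out_shape a, s & ss]
| Down s ss (p : unet_path R s0 (s :: ss))
    (eh : ~~ odd (height s)) (ew : ~~ odd (width s)) :
    unet_path R s0 [:: pool_shape s, s & ss]
| Up s ss (p : unet_path R s0 (s :: ss)) (h w : nat)
    (P0 : 'M[R]_(sdim (Shape (channels s) h w), sdim s))
    (P01 : forall k l, P0 k l = 0 \/ P0 k l = 1)
    (a : conv_bn R 2 2 (Shape (channels s) h w)) :
    unet_path R s0 [:: out_shape a, out_shape a, s & ss].

Fixpoint run (R : realType) (eps : R) (s0 : img_shape) (ss : seq img_shape)
    (p : unet_path R s0 ss) (x : img R s0) : history R ss :=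
  match p in unet_path _ _ ss return history R ss with
  | Input => (x, tt)
  | Right s ss p q a =>
      let h := run eps p x in
      let u := conv_layer eps a (pad_mx R q s) h.1 in
      (scale_layer u, (u, h))
  | ConcatRight s ss p j eh ew q a =>
      let h := run eps p x in
      let u := conv_layer eps a (pad_mx R q _) (concat eh ew (recall h j) h.1) in
      (scale_layer u, (u, h))
  | Down s ss p _ _ =>
      let h := run eps p x in
      (layer (@maxpool R s) 0 1%:M h.1, h)
  | Up s ss p _ _ P0 _ a =>
      let h := run eps p x in
      let u := conv_layer eps a P0 h.1 in
      (scale_layer u, (u, h))
  end.

Variant arrow := right_arrow | concat_right_arrow | down_arrow | up_arrow.

Fixpoint arrows (R : realType) (s0 : img_shape) (ss : seq img_shape)
    (p : unet_path R s0 ss) : seq arrow :=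
  match p with
  | Input => [::]
  | Right _ _ p _ _ => rcons (arrows p) right_arrow
  | ConcatRight _ _ p _ _ _ _ _ => rcons (arrows p) concat_right_arrow
  | Down _ _ p _ _ => rcons (arrows p) down_arrow
  | Up _ _ p _ _ _ _ _ => rcons (arrows p) up_arrow
  end.

(* [d] is the number of levels that remain to be climbed.  Each up arrow is
   followed by a right arrow with concatenation, the first convolution of the
   level that it reaches. *)
Fixpoint expanding (d : nat) (w : seq arrow) : bool :=
  match w with
  | [::] => d == 0%N
  | right_arrow :: w' => expanding d w'
  | up_arrow :: concat_right_arrow :: w' => (0 < d)%N && expanding d.-1 w'
  | _ => false
  end.

Fixpoint contracting (d : nat) (w : seq arrow) : bool :=
  match w with
  | right_arrow :: w' => contracting d w'
  | down_arrow :: w' => contracting d.+1 w'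
  | _ => expanding d w
  end.

Definition u_shaped (w : seq arrow) : bool :=
  if w is right_arrow :: w' then contracting 0 w' else false.

(* All the arrows but the last right arrow are in [body]. *)
Record modified_unet (R : realType) (s0 : img_shape) := ModifiedUnet {
  body_shape : img_shape;
  body_shapes : seq img_shape;
  body : unet_path R s0 (body_shape :: body_shapes);
  body_u_shaped : u_shaped (arrows body);
  last_padding : padding;
  last_kernel : tensor R 1 1 (channels (pad_shape last_padding body_shape)) 1;
  last_scalar : R }.

Arguments last_kernel {R s0}.

Definition unet_out (R : realType) (s0 : img_shape) (N : modified_unet R s0) :
    img_shape :=
  conv_shape 1 1 1 (pad_shape (last_padding N) (body_shape N)).

Definition last_bias (R : realType) (s0 : img_shape) (N : modified_unet R s0) :
    img R (unet_out N) :=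
  const_mx (last_scalar N).

Definition unet (R : realType) (s0 : img_shape) (eps : R) (N : modified_unet R s0)
    (x : img R s0) : img R (unet_out N) :=
  layer id (last_bias N) (conv_mx (last_kernel N) *m pad_mx R _ _)
    (run eps (body N) x).1.

(* [ss] has one entry for each of z^1, ..., z^k, so [size ss] = k is the index of
   the layer that acts next. *)
Fixpoint path_convs (R : realType) (s0 : img_shape)
    (Q : nat -> forall m n : nat, 'M[R]_(m, n) -> Prop)
    (ss : seq img_shape) (p : unet_path R s0 ss) : Prop :=
  match p with
  | Input => True
  | Right s ss p _ a =>
      path_convs Q p /\ Q (size (s :: ss)) _ _ (conv_mx (kernel a))
  | ConcatRight s ss p _ _ _ _ a =>
      path_convs Q p /\ Q (size (s :: ss)) _ _ (conv_mx (kernel a))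
  | Down _ _ p _ _ => path_convs Q p
  | Up s ss p _ _ _ _ a =>
      path_convs Q p /\ Q (size (s :: ss)) _ _ (conv_mx (kernel a))
  end.

Fixpoint path_scales (R : realType) (s0 : img_shape)
    (Q : nat -> forall n : nat, 'cV[R]_n -> Prop)
    (ss : seq img_shape) (p : unet_path R s0 ss) : Prop :=
  match p with
  | Input => True
  | Right s ss p _ a => path_scales Q p /\ Q (size (s :: ss)) _ (bn_scale a)
  | ConcatRight s ss p _ _ _ _ a =>
      path_scales Q p /\ Q (size (s :: ss)) _ (bn_scale a)
  | Down _ _ p _ _ => path_scales Q p
  | Up s ss p _ _ _ _ a => path_scales Q p /\ Q (size (s :: ss)) _ (bn_scale a)
  end.

Definition depth (R : realType) (s0 : img_shape) (N : modified_unet R s0) : nat :=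
  size (body_shape N :: body_shapes N).

(* [Q k K^k] holds for every layer k at which a convolution occurs. *)
Definition forall_convs (R : realType) (s0 : img_shape) (N : modified_unet R s0)
    (Q : nat -> forall m n : nat, 'M[R]_(m, n) -> Prop) : Prop :=
  path_convs Q (body N) /\ Q (depth N) _ _ (conv_mx (last_kernel N)).

(* [Q k gamma^k] holds for every layer k at which a batch-normalized convolution
   occurs. *)
Definition forall_scales (R : realType) (s0 : img_shape) (N : modified_unet R s0)
    (Q : nat -> forall n : nat, 'cV[R]_n -> Prop) : Prop :=
  path_scales Q (body N).

Definition mx_ge0 (R : realType) (m n : nat) (A : 'M[R]_(m, n)) : Prop :=
  forall i j, 0 <= A i j.

(* Main.v *)
Require Import Defs.
From mathcomp Require Import all_boot all_order all_algebra.
From mathcomp Require Import all_classical all_reals.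
From mathcomp Require Import convex.
From mathcomp Require Import interval_inference ring.

(** Affine maps with nonnegative matrices, nondecreasing affine normalizations,
    ReLU and max-pooling all preserve component-wise convexity, and so does
    concatenation.  The first convolution may have entries of any sign because
    it acts on the input itself, which is an affine function of the input, and
    affine functions stay affine under any affine map.  Nonnegativity appears
    with the first ReLU, is preserved by max-pooling, and then survives the last
    nonnegative affine map. *)

Import Order.TTheory GRing.Theory Num.Theory.

Local Open Scope ring_scope.

Set Implicit Arguments.
Unset Strict Implicit.

Section Nonnegative.
Context {R : realType}.

Lemma mulmx_ge0 (m n p : nat) (A : 'M[R]_(m, n)) (B : 'M[R]_(n, p)) :
  mx_ge0 A -> mx_ge0 B -> mx_ge0 (A *m B).
Proof. by move=> A0 B0 i k; rewrite mxE sumr_ge0 // => j _; apply: mulr_ge0. Qed.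

Lemma addmx_ge0 (m n : nat) (A B : 'M[R]_(m, n)) :
  mx_ge0 A -> mx_ge0 B -> mx_ge0 (A + B).
Proof. by move=> A0 B0 i j; rewrite mxE addr_ge0. Qed.

Lemma diag_mx_ge0 (n : nat) (d : 'cV[R]_n) : mx_ge0 d -> mx_ge0 (diag_mx d^T).
Proof. by move=> d0 i j; rewrite !mxE mulrn_wge0. Qed.

Lemma scalar1_mx_ge0 (n : nat) : mx_ge0 (1%:M : 'M[R]_n).
Proof. by move=> i j; rewrite mxE mulrn_wge0. Qed.

Lemma pad_mx_ge0 (q : padding) (s : img_shape) : mx_ge0 (pad_mx R q s).
Proof. by move=> i j; rewrite mxE ler0n. Qed.

Lemma relu_ge0 (n : nat) (u : 'cV[R]_n) : mx_ge0 (relu u).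
Proof. by move=> i j; rewrite mxE le_max lexx. Qed.

Lemma maxpool_ge0 (s : img_shape) (z : img R s) : mx_ge0 z -> mx_ge0 (maxpool z).
Proof. by move=> z0 i j; rewrite mxE !le_max z0. Qed.

End Nonnegative.

Section Convexity.
Context {R : realType} {V : lmodType R}.
Implicit Types (t : R) (x y : V).

(** Keeping the convexity defect as a vector makes convexity its nonnegativity and affinity its
    vanishing, so one identity for the gap serves both. *)
Definition convex_gap (n : nat) (f : V -> 'cV[R]_n) t x y : 'cV[R]_n :=
  t *: f x + (1 - t) *: f y - f (t *: x + (1 - t) *: y).

Definition cw_convex (n : nat) (f : V -> 'cV[R]_n) : Prop :=
  forall t x y, 0 <= t <= 1 -> mx_ge0 (convex_gap f t x y).

Definition cw_affine (n : nat) (f : V -> 'cV[R]_n) : Prop :=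
  forall t x y, convex_gap f t x y = 0.

Lemma cw_convexP (n : nat) (f : V -> 'cV[R]_n) :
  cw_convex f <-> forall t x y, 0 <= t <= 1 -> forall i,
    f (t *: x + (1 - t) *: y) i 0 <= t * f x i 0 + (1 - t) * f y i 0.
Proof.
split=> cf t x y t01 i; first by have := cf t x y t01 i 0; rewrite !mxE subr_ge0.
by move=> j; rewrite ord1 !mxE subr_ge0 cf.
Qed.

Lemma cw_affine_convex (n : nat) (f : V -> 'cV[R]_n) : cw_affine f -> cw_convex f.
Proof. by move=> af t x y _ i j; rewrite af mxE. Qed.

Lemma cw_affine_cst (n : nat) (c : 'cV[R]_n) : cw_affine (fun=> c).
Proof.
by move=> t x y; rewrite /convex_gap -scalerDl [t + _]addrC subrK scale1r subrr.
Qed.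

(** The weights [t] and [1 - t] sum to 1, so the bias cancels and only the linear part acts. *)
Lemma convex_gap_affine (m n : nat) (b : 'cV[R]_n) (W : 'M[R]_(n, m))
    (f : V -> 'cV[R]_m) t x y :
  convex_gap (fun z => b + W *m f z) t x y = W *m convex_gap f t x y.
Proof.
rewrite /convex_gap mulmxBr mulmxDr -!scalemxAr.
by apply/matrixP=> i j; rewrite !mxE; ring.
Qed.

Lemma cw_convex_affine (m n : nat) (b : 'cV[R]_n) (W : 'M[R]_(n, m))
    (f : V -> 'cV[R]_m) :
  mx_ge0 W -> cw_convex f -> cw_convex (fun x => b + W *m f x).
Proof.
by move=> W0 cf t x y t01; rewrite convex_gap_affine; exact/mulmx_ge0/cf.
Qed.

Lemma cw_affine_affine (m n : nat) (b : 'cV[R]_n) (W : 'M[R]_(n, m))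
    (f : V -> 'cV[R]_m) :
  cw_affine f -> cw_affine (fun x => b + W *m f x).
Proof. by move=> af t x y; rewrite convex_gap_affine af mulmx0. Qed.

(** The mean cancels, and each entry of the gap is multiplied by the inverse of a square root, which
    is nonnegative. *)
Lemma cw_convex_normalize (n : nat) (eps : R) (mean var : 'cV[R]_n)
    (f : V -> 'cV[R]_n) :
  cw_convex f -> cw_convex (fun x => normalize eps mean var (f x)).
Proof.
move=> cf t x y t01 i j; rewrite ord1 !mxE.
have := cf t x y t01 i 0; rewrite !mxE.
have : 0 <= (Num.sqrt (var i 0 + eps))^-1 by rewrite invr_ge0 sqrtr_ge0.
set r := (Num.sqrt _)^-1 => r0 g0.
by apply: (le_trans (mulr_ge0 g0 r0)); rewrite le_eqVlt; apply/orP/or_introl/eqP; ring.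
Qed.

Lemma max_convex_comb t (a b c a' b' c' : R) : 0 <= t <= 1 ->
  c <= t * a + (1 - t) * b -> c' <= t * a' + (1 - t) * b' ->
  Num.max c c' <= t * Num.max a a' + (1 - t) * Num.max b b'.
Proof.
move=> /andP[t0 t1] h h'; have s0 : 0 <= 1 - t by rewrite subr_ge0.
rewrite ge_max; apply/andP; split; [apply: (le_trans h) | apply: (le_trans h')];
  by apply: lerD; apply: ler_wpM2l; rewrite // le_max lexx ?orbT.
Qed.

Lemma cw_convex_relu (n : nat) (f : V -> 'cV[R]_n) :
  cw_convex f -> cw_convex (fun x => relu (f x)).
Proof.
move=> /cw_convexP cf; apply/cw_convexP => t x y t01 i; rewrite !mxE.
(* ReLU is a maximum with the constant 0, for which the convexity inequality is an equality. *)
by apply: max_convex_comb => //; [rewrite !mulr0 addr0 | exact: cf].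
Qed.

Lemma cw_convex_maxpool (s : img_shape) (f : V -> img R s) :
  cw_convex f -> cw_convex (fun x => maxpool (f x)).
Proof.
move=> /cw_convexP cf; apply/cw_convexP => t x y t01 i; rewrite !mxE.
by do 2![apply: max_convex_comb => //]; apply: cf.
Qed.

Lemma convex_gap_concat (s u : img_shape) (eh : height s = height u)
    (ew : width s = width u) (f : V -> img R s) (g : V -> img R u) t x y :
  convex_gap (fun z => concat eh ew (f z) (g z)) t x y =
  concat eh ew (convex_gap f t x y) (convex_gap g t x y).
Proof.
rewrite /concat /convex_gap; move: (concat_sdim eh ew) => e.
by apply/matrixP=> i j; rewrite !(castmxE, mxE); case: fintype.splitP => k _; rewrite !mxE.
Qed.

Lemma cw_affine_concat (s u : img_shape) (eh : height s = height u)
    (ew : width s = width u) (f : V -> img R s) (g : V -> img R u) :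
  cw_affine f -> cw_affine g -> cw_affine (fun z => concat eh ew (f z) (g z)).
Proof.
move=> af ag t x y.
by rewrite convex_gap_concat af ag /concat col_mx0 castmx_const.
Qed.

Lemma cw_convex_concat (s u : img_shape) (eh : height s = height u)
    (ew : width s = width u) (f : V -> img R s) (g : V -> img R u) :
  cw_convex f -> cw_convex g -> cw_convex (fun z => concat eh ew (f z) (g z)).
Proof.
move=> cf cg t x y t01 i j; rewrite convex_gap_concat castmxE mxE.
by case: fintype.splitP => k _; [apply: cf | apply: cg].
Qed.

(** The disjunction separates the later convolutions, with nonnegative kernel, from the first one,
    whose kernel is arbitrary but whose argument is affine. *)
Lemma cw_convex_conv_layer (eps : R) (f1 f2 : nat) (s : img_shape) (n : nat)
    (a : conv_bn R f1 f2 s) (P0 : 'M[R]_(sdim s, n)) (f : V -> 'cV[R]_n) :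
  mx_ge0 P0 -> cw_convex f -> mx_ge0 (conv_mx (kernel a)) \/ cw_affine f ->
  cw_convex (fun x => conv_layer eps a P0 (f x)).
Proof.
move=> P0_ge0 cf Kf; apply: cw_convex_normalize; case: Kf => [K0 | af].
  by apply: cw_convex_affine => //; exact: mulmx_ge0.
exact/cw_affine_convex/cw_affine_affine.
Qed.

Lemma cw_convex_scale_layer (f1 f2 : nat) (s : img_shape) (a : conv_bn R f1 f2 s)
    (f : V -> img R (out_shape a)) :
  mx_ge0 (bn_scale a) -> cw_convex f -> cw_convex (fun x => scale_layer (f x)).
Proof.
by move=> a0 cf; apply/cw_convex_relu/cw_convex_affine => //; exact: diag_mx_ge0.
Qed.

End Convexity.

Lemma cw_affine_id {R : realType} (n : nat) : cw_affine (@id 'cV[R]_n).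
Proof. by move=> t x y; rewrite /convex_gap subrr. Qed.

Section Paths.
Context {R : realType} (eps : R) {s0 : img_shape}.

(** Induction on the path. All indices [j] are treated at once because a concatenation may recall
    any earlier layer; the affine clause concerns the history that holds only the input, which is
    what the first convolution sees. *)
Lemma run_cw_convex (ss : seq img_shape) (p : unet_path R s0 ss) :
  path_convs (fun k m n K => (2 <= k)%N -> mx_ge0 K) p ->
  path_scales (fun k n gamma => (1 <= k)%N -> mx_ge0 gamma) p ->
  forall j, cw_convex (fun x => recall (run eps p x) j) /\
            (size ss = 1%N -> cw_affine (fun x => recall (run eps p x) j)).
Proof.
have first_or_ge0 k (P Q : Prop) :
    (2 <= k.+1 -> P)%N -> (k.+1 = 1%N -> Q) -> P \/ Q.
  by case: k => [|k] hP hQ; [right; exact: hQ | left; exact: hP].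
elim: p => {ss} [|s ss p IH q a|s ss p IH j eh ew q a|s ss p IH eh ew
              |s ss p IH h w P0 P01 a] /=.
(* Beyond the input, [recall] returns its default value 0, a constant map. *)
- move=> _ _ [|j]; last by split=> [|_]; [apply: cw_affine_convex|];
    case: j => [|j]; apply: cw_affine_cst.
  by split=> [|_]; [apply: cw_affine_convex|]; apply: cw_affine_id.
- move=> [hK K0] [hg g0]; have {}IH := IH hK hg; have [c0 a0] := IH 0%N.
  have cu : cw_convex (fun x => conv_layer eps a (pad_mx R q s) (run eps p x).1).
    by apply: cw_convex_conv_layer; [exact: pad_mx_ge0|exact: c0|
      exact: first_or_ge0 K0 a0].
  (* Indices 0 and 1 are the two new layers. The affine clause is vacuous, since the history now has
     more than one entry. *)
  case=> [|[|j]]; split=> //; last by case: (IH j).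
  by apply: cw_convex_scale_layer => //; exact: g0.
- move=> [hK K0] [hg g0]; have {}IH := IH hK hg; have [c0 a0] := IH 0%N.
  have [cj aj] := IH j.
  have cu : cw_convex (fun x => conv_layer eps a (pad_mx R q _)
      (concat eh ew (recall (run eps p x) j) (run eps p x).1)).
    apply: cw_convex_conv_layer; [exact: pad_mx_ge0|exact: cw_convex_concat|].
    (* At the first layer the concatenation can only join the input with itself, which is still
       affine. *)
    apply: first_or_ge0 K0 _ => e; exact: cw_affine_concat (aj e) (a0 e).
  case=> [|[|i]]; split=> //; last by case: (IH i).
  by apply: cw_convex_scale_layer => //; exact: g0.
- move=> hK hg; have {}IH := IH hK hg; have [c0 _] := IH 0%N.
  case=> [|j]; split=> //; last by case: (IH j).
  by apply/cw_convex_maxpool/cw_convex_affine => //; exact: scalar1_mx_ge0.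
- move=> [hK K0] [hg g0]; have {}IH := IH hK hg; have [c0 a0] := IH 0%N.
  have P0_ge0 : mx_ge0 P0 by move=> k l; case: (P01 k l) => ->.
  have cu : cw_convex (fun x => conv_layer eps a P0 (run eps p x).1).
    by apply: cw_convex_conv_layer; [|exact: c0|exact: first_or_ge0 K0 a0].
  case=> [|[|j]]; split=> //; last by case: (IH j).
  by apply: cw_convex_scale_layer => //; exact: g0.
Qed.

(** Starting with a right arrow ensures that a ReLU precedes every max-pooling, so no pooling acts
    on the raw input. *)
Lemma run_ge0 (ss : seq img_shape) (p : unet_path R s0 ss) (x : img R s0) :
  ohead (arrows p) = Some right_arrow -> mx_ge0 (recall (run eps p x) 0).
Proof.
elim: p => {ss} //= [*|*|s ss p IH _ _|*]; try exact: relu_ge0.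
(* An empty prefix would make the down arrow the first one; otherwise appending it leaves the first
   arrow unchanged. *)
case E: (arrows p) IH => [//|w ws] /= IH hw.
apply: maxpool_ge0; rewrite add0r mul1mx; exact: IH.
Qed.

(** This places the last convolution at a layer of index at least 2, where kernels are assumed
    nonnegative. *)
Lemma size_path_gt1 (ss : seq img_shape) (p : unet_path R s0 ss) :
  arrows p <> [::] -> (1 < size ss)%N.
Proof. by case: p. Qed.

End Paths.

Unset Implicit Arguments.
Set Strict Implicit.

Theorem proposition4p2 (R : realType) (eps : R) (heps : 0 < eps) (s0 : img_shape)
    (N : modified_unet R s0)
    (hK : forall_convs N (fun k m n K => (2 <= k)%N -> mx_ge0 K))
    (hgamma : forall_scales N (fun k n gamma => (1 <= k)%N -> mx_ge0 gamma))
    (hb : mx_ge0 (last_bias N)) :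
  (forall i : 'I_(sdim (unet_out N)),
     @convex_function R 'cV[R]_(sdim s0) setT (fun x => unet eps N x i 0)) /\
  (forall (x : img R s0) (i : 'I_(sdim (unet_out N))), 0 <= unet eps N x i 0).
Proof.
have right_first : ohead (arrows (body N)) = Some right_arrow.
  by case: (arrows (body N)) (body_u_shaped N) => [|[]].
have [hKbody hKlast] := hK.
have W0 : mx_ge0 (conv_mx (last_kernel N) *m pad_mx R _ _).
  apply: mulmx_ge0; last exact: pad_mx_ge0.
  apply: hKlast; apply: (size_path_gt1 (p := body N)) => e.
  by rewrite e in right_first.
split=> [i t x y _ _ | x i]; last first.
  apply: addmx_ge0 => //; apply: mulmx_ge0 => //.
  exact: (run_ge0 eps x right_first).
have [/(cw_convex_affine (last_bias N) W0)/cw_convexP cN _] :=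
  run_cw_convex eps hKbody hgamma 0.
(* The convex combination in [convex_function] unfolds to the weights [t%:num] and [1 - t%:num]. *)
by apply: (cN t%:num x y _ i); rewrite ge0 le1.
Qed.
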